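(* For $n>4$, the principal $\mathrm{PGL}_3(\mathbb{C})$-bundle $F_n\to X_n$ is trivial.
   Context: $F_n\subset(\mathbb{CP}^2)^n$ is the space of ordered $n$-tuples of distinct points of $\mathbb{CP}^2$, no three of which lie on a line. $\mathrm{PGL}_3(\mathbb{C})$ acts on $F_n$ diagonally and freely, $X_n=F_n/\mathrm{PGL}_3(\mathbb{C})$, and the quotient map $F_n\to X_n$ is a principal $\mathrm{PGL}_3(\mathbb{C})$-bundle. *)

(* Defs.v *)
From HB Require Import structures.
From mathcomp Require Import all_boot all_algebra generic_quotient.
From mathcomp Require Import all_classical all_reals all_analysis.
From mathcomp.real_closed Require Import complex.
Import GRing.Theory.
Import numFieldNormedType.Exports.

Set Implicit Arguments.
Unset Strict Implicit.
Unset Printing Implicit Defensive.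

Local Open Scope classical_set_scope.
Local Open Scope ring_scope.
Local Open Scope quotient_scope.

(* A principal G-bundle p : P -> B, with G acting on the left of P by act, is
   trivial when it is isomorphic, as a G-space over B, to the product bundle
   B * G on which G acts by left multiplication on the second factor. *)
Definition trivial_principal_bundle (G P B : topologicalType)
    (mul : G -> G -> G) (act : G -> P -> P) (p : P -> B) : Prop :=
  exists (f : P -> B * G) (f' : B * G -> P),
    [/\ cancel f f' /\ cancel f' f,
        continuous f /\ continuous f',
        forall x, (f x).1 = p x
      & forall g x, f (act g x) = ((f x).1, mul g (f x).2)].

(* Everything below is developed over a numFieldType K, with the topology
   given by its absolute value; the case of interest is K = R[i]. *)

Section ProjectivePlane.
Variable K : numFieldType.

Definition nzvec : set 'cV[K]_3 := [set v | v != 0].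

Definition proportional (u v : nzvec) : bool :=
  `[< exists2 c : K, c != 0 & val v = c *: val u >].

Lemma proportional_equiv : equiv_class_of proportional.
Proof.
split=> [u|u v|v u w].
- by apply/asboolP; exists 1; rewrite ?oner_neq0 ?scale1r.
- apply/asboolP/asboolP => -[c c0 e]; exists c^-1; rewrite ?invr_eq0 //.
    by rewrite e scalerA mulVf // scale1r.
  by rewrite e scalerA mulVf // scale1r.
- move=> /asboolP[c c0 e] /asboolP[d d0 e']; apply/asboolP.
  by exists (d * c); rewrite ?mulf_neq0 // e' e scalerA.
Qed.

Canonical proportional_equiv_rel := EquivRelPack proportional_equiv.

Definition P2 : topologicalType :=
  quotient_topology {eq_quot proportional_equiv_rel}.

Definition p2_coord (p : P2) : 'cV[K]_3 := val (repr p).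

(* The vanishing of l on p does not depend on the representative of p, see
   line_pi. *)
Definition line (l : 'rV[K]_3) : set P2 := [set p | l *m p2_coord p = 0].

Definition collinear (p q r : P2) : Prop :=
  exists2 l : 'rV[K]_3, l != 0 & [/\ line l p, line l q & line l r].

End ProjectivePlane.

Arguments nzvec : clear implicits.

Section ProjectiveLinearGroup.
Variable K : numFieldType.

Definition GL3 : set 'M[K]_3 := [set A | A \in unitmx].

Lemma gl_unit (A : GL3) : val A \in unitmx.
Proof. exact: (set_mem (valP A)). Qed.

Definition gl_of (A : 'M[K]_3) (uA : A \in unitmx) : GL3 :=
  exist _ A (mem_set uA).

Lemma gl_mul_subproof (A B : GL3) : val A *m val B \in unitmx.
Proof. by rewrite unitmx_mul !gl_unit. Qed.

Lemma gl_inv_subproof (A : GL3) : invmx (val A) \in unitmx.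
Proof. by rewrite unitmx_inv gl_unit. Qed.

Definition gl_mul (A B : GL3) : GL3 := gl_of (gl_mul_subproof A B).
Definition gl_inv (A : GL3) : GL3 := gl_of (gl_inv_subproof A).
Definition gl_one : GL3 := gl_of (unitmx1 K 3).

Definition gl_proportional (A B : GL3) : bool :=
  `[< exists2 c : K, c != 0 & val B = c *: val A >].

Lemma gl_proportional_equiv : equiv_class_of gl_proportional.
Proof.
split=> [u|u v|v u w].
- by apply/asboolP; exists 1; rewrite ?oner_neq0 ?scale1r.
- apply/asboolP/asboolP => -[c c0 e]; exists c^-1; rewrite ?invr_eq0 //.
    by rewrite e scalerA mulVf // scale1r.
  by rewrite e scalerA mulVf // scale1r.
- move=> /asboolP[c c0 e] /asboolP[d d0 e']; apply/asboolP.
  by exists (d * c); rewrite ?mulf_neq0 // e' e scalerA.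
Qed.

Canonical gl_proportional_equiv_rel := EquivRelPack gl_proportional_equiv.

Definition PGL3 : Type :=
  quotient_topology {eq_quot gl_proportional_equiv_rel}.

HB.instance Definition _ := Topological.on PGL3.
HB.instance Definition _ := Quotient.on PGL3.

Lemma pgl_eqP (A B : GL3) :
  reflect (exists2 c : K, c != 0 & val B = c *: val A)
          (\pi_PGL3 A == \pi_PGL3 B).
Proof.
have eqAB := @eqmodP _ gl_proportional_equiv_rel A B.
by apply: (iffP eqP) => [/eqAB/asboolP|/asboolP/eqAB].
Qed.

Definition pgl_mul (g h : PGL3) : PGL3 := \pi_PGL3 (gl_mul (repr g) (repr h)).
Definition pgl_inv (g : PGL3) : PGL3 := \pi_PGL3 (gl_inv (repr g)).
Definition pgl_one : PGL3 := \pi_PGL3 gl_one.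

Lemma pgl_repr (A : GL3) :
  exists2 c : K, c != 0 & val (repr (\pi_PGL3 A)) = c *: val A.
Proof. by apply/pgl_eqP; rewrite reprK. Qed.

Lemma pgl_mulE (A B : GL3) : pgl_mul (\pi_PGL3 A) (\pi_PGL3 B) = \pi_PGL3 (gl_mul A B).
Proof.
apply/esym/eqP/pgl_eqP; rewrite /=.
have [c c0 ->] := pgl_repr A; have [d d0 ->] := pgl_repr B.
by exists (c * d); rewrite ?mulf_neq0 // -scalemxAl -scalemxAr scalerA.
Qed.

Lemma pgl_invE (A : GL3) : pgl_inv (\pi_PGL3 A) = \pi_PGL3 (gl_inv A).
Proof.
apply/esym/eqP/pgl_eqP; rewrite /=.
have [c c0 ->] := pgl_repr A.
exists c^-1; rewrite ?invr_eq0 //.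
by rewrite invmxZ // unitmxZ ?unitfE // gl_unit.
Qed.

Lemma pgl_mulA : associative pgl_mul.
Proof.
elim/quotW=> A; elim/quotW=> B; elim/quotW=> C; rewrite (pgl_mulE B C) (pgl_mulE A B) !pgl_mulE.
by apply: (congr1 \pi_PGL3); apply: val_inj; rewrite /= mulmxA.
Qed.

Lemma pgl_mul1g : left_id pgl_one pgl_mul.
Proof.
elim/quotW=> A; rewrite pgl_mulE.
by apply: (congr1 \pi_PGL3); apply: val_inj; rewrite /= mul1mx.
Qed.

Lemma pgl_mulg1 : right_id pgl_one pgl_mul.
Proof.
elim/quotW=> A; rewrite pgl_mulE.
by apply: (congr1 \pi_PGL3); apply: val_inj; rewrite /= mulmx1.
Qed.

Lemma pgl_mulVg : left_inverse pgl_one pgl_inv pgl_mul.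
Proof.
elim/quotW=> A; rewrite (pgl_invE A) pgl_mulE.
by apply: (congr1 \pi_PGL3); apply: val_inj; rewrite /= mulVmx // gl_unit.
Qed.

Lemma pgl_mulgV : right_inverse pgl_one pgl_inv pgl_mul.
Proof.
elim/quotW=> A; rewrite (pgl_invE A) pgl_mulE.
by apply: (congr1 \pi_PGL3); apply: val_inj; rewrite /= mulmxV // gl_unit.
Qed.

HB.instance Definition _ := isGroup.Build PGL3
  pgl_mulA pgl_mul1g pgl_mulg1 pgl_mulVg pgl_mulgV.

End ProjectiveLinearGroup.

Arguments GL3 : clear implicits.

Section Action.
Variable K : numFieldType.
Local Notation P2 := (P2 K).
Local Notation PGL3 := (PGL3 K).

Lemma gl_act_subproof (A : GL3 K) (v : nzvec K) :
  (val A *m val v) \in nzvec K.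
Proof.
apply/mem_set/eqP => /(congr1 (mulmx (invmx (val A)))).
rewrite mulKmx ?gl_unit // mulmx0; apply/eqP; exact: (set_mem (valP v)).
Qed.

Definition gl_act (A : GL3 K) (v : nzvec K) : nzvec K :=
  exist _ (val A *m val v) (gl_act_subproof A v).

Definition p2_act (g : PGL3) (p : P2) : P2 :=
  \pi_P2 (gl_act (repr g) (repr p)).

Lemma p2_eqP (u v : nzvec K) :
  reflect (exists2 c : K, c != 0 & val v = c *: val u)
          (\pi_P2 u == \pi_P2 v).
Proof.
have equv := @eqmodP _ (@proportional_equiv_rel K) u v.
by apply: (iffP eqP) => [/equv/asboolP|/asboolP/equv].
Qed.

Lemma p2_repr (u : nzvec K) :
  exists2 c : K, c != 0 & val (repr (\pi_P2 u)) = c *: val u.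
Proof. by apply/p2_eqP; rewrite reprK. Qed.

Lemma p2_actE (A : GL3 K) (v : nzvec K) :
  p2_act (\pi_PGL3 A) (\pi_P2 v) = \pi_P2 (gl_act A v).
Proof.
apply/esym/eqP/p2_eqP; rewrite /=.
have [c c0 ->] := pgl_repr A; have [d d0 ->] := p2_repr v.
by exists (c * d); rewrite ?mulf_neq0 // -scalemxAl -scalemxAr scalerA.
Qed.

Lemma p2_act1 (p : P2) : p2_act 1%g p = p.
Proof.
elim/quotW: p => v; rewrite [1%g]/(pgl_one K) p2_actE.
by apply: (congr1 \pi_P2); apply: val_inj; rewrite /= mul1mx.
Qed.

Lemma p2_actM (g h : PGL3) (p : P2) :
  p2_act (g * h)%g p = p2_act g (p2_act h p).
Proof.
elim/quotW: g => A; elim/quotW: h => B; elim/quotW: p => v.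
have -> : (\pi_PGL3 A * \pi_PGL3 B)%g = \pi_PGL3 (gl_mul A B) := pgl_mulE A B.
rewrite (p2_actE B v) !p2_actE.
by apply: (congr1 \pi_P2); apply: val_inj; rewrite /= mulmxA.
Qed.

Lemma line_pi (l : 'rV[K]_3) (v : nzvec K) :
  line l (\pi_P2 v) <-> l *m val v = 0.
Proof.
rewrite /line /p2_coord /=; have [c c0 ->] := p2_repr v.
rewrite -scalemxAr; split=> [/eqP|->]; last by rewrite scaler0.
by rewrite scaler_eq0 (negbTE c0) => /eqP.
Qed.

Lemma line_act (g : PGL3) (l : 'rV[K]_3) (p : P2) :
  line l (p2_act g p) <-> line (l *m val (repr g)) p.
Proof.
by rewrite /p2_act line_pi /= mulmxA.
Qed.

Lemma collinear_act (g : PGL3) (p q r : P2) :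
  collinear (p2_act g p) (p2_act g q) (p2_act g r) -> collinear p q r.
Proof.
move=> [l l0 [/line_act lp /line_act lq /line_act lr]].
exists (l *m val (repr g)) => //.
apply: contra_neq l0 => /(congr1 (mulmxr (invmx (val (repr g))))).
by rewrite /= mulmxK ?gl_unit // mul0mx.
Qed.

Variable n : nat.

Definition general_position (x : 'I_n -> P2) : Prop :=
  injective x /\
  forall i j k : 'I_n, i != j -> j != k -> i != k ->
    ~ collinear (x i) (x j) (x k).

(* ptws is the product topology on (P2)^n, and a set coerces to the subtype of
   its elements with the subspace topology. *)
Definition F : set {ptws 'I_n -> P2} := [set x | general_position x].

Lemma F_act_subproof (g : PGL3) (x : F) :
  ((fun i => p2_act g (val x i)) : {ptws 'I_n -> P2}) \in F.
Proof.
have [xinj xcol] := set_mem (valP x).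
apply/mem_set; split=> [i j /(congr1 (p2_act g^-1%g))|i j k ij jk ik].
  by rewrite -!p2_actM mulVg !p2_act1 => /xinj.
by move=> /collinear_act; exact: xcol.
Qed.

Definition F_act (g : PGL3) (x : F) : F :=
  exist (fun y => y \in F) _ (F_act_subproof g x).

Lemma F_act1 (x : F) : F_act 1%g x = x.
Proof. by apply/val_inj/funext => i /=; rewrite p2_act1. Qed.

Lemma F_actM (g h : PGL3) (x : F) : F_act (g * h)%g x = F_act g (F_act h x).
Proof. by apply/val_inj/funext => i /=; rewrite p2_actM. Qed.

Definition same_orbit (x y : F) : bool :=
  `[< exists g : PGL3, y = F_act g x >].

Lemma same_orbit_equiv : equiv_class_of same_orbit.
Proof.
split=> [x|x y|y x z].
- by apply/asboolP; exists 1%g; rewrite F_act1.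
- by apply/asboolP/asboolP => -[g ->]; exists g^-1%g;
    rewrite -F_actM mulVg F_act1.
- move=> /asboolP[g ->] /asboolP[h ->]; apply/asboolP.
  by exists (h * g)%g; rewrite F_actM.
Qed.

Canonical same_orbit_equiv_rel := EquivRelPack same_orbit_equiv.

Definition X : topologicalType :=
  quotient_topology {eq_quot same_orbit_equiv_rel}.

Definition F_proj : F -> X := \pi_X.

End Action.

Arguments F : clear implicits.

(* Main.v *)
(* The first four points of a configuration form a projective frame, so exactly
   one element of PGL_3 carries the standard frame to it. Sending x to this
   element is a continuous equivariant map F_n -> PGL_3, that is, a
   trivialization. Maps out of P^2 and PGL_3 are shown to be continuous through
   sections of the quotient maps, continuous at a prescribed point. *)
Require Import Defs.
From mathcomp Require Import all_boot all_algebra generic_quotient.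
From mathcomp Require Import all_classical all_reals all_analysis.
From mathcomp.real_closed Require Import complex.
Import GRing.Theory.
Import numFieldNormedType.Exports.

Local Open Scope classical_set_scope.
Local Open Scope ring_scope.
Local Open Scope quotient_scope.

Lemma continuous_at_val (T X : topologicalType) (A : set X) (f : T -> A) x :
  {for x, continuous (fun t => val (f t))} -> {for x, continuous f}.
Proof.
move=> cf U [_ [[W oW <-] /= Wfx]] /filterS; apply.
exact/cf/open_nbhs_nbhs.
Qed.

Lemma cvg_val {T : Type} {F : set_system T} {X : topologicalType} {A : set X}
    {f : T -> A} {a : A} :
  f @ F --> a -> val (f t) @[t --> F] --> val a.
Proof.
by move=> fa; exact: (cvg_comp f val fa (@initial_continuous A X set_val a)).
Qed.

Lemma continuous_at_pair (T U V : topologicalType) (f : T -> U) (g : T -> V) x :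
  {for x, continuous f} -> {for x, continuous g} ->
  {for x, continuous (fun t => (f t, g t))}.
Proof. by move=> cf cg; apply: cvg_pair; [exact: cf | exact: cg]. Qed.

Lemma continuous_at_ptws (T V : topologicalType) (I : eqType)
    (f : T -> {ptws I -> V}) x :
  (forall i, {for x, continuous (fun t => f t i)}) -> {for x, continuous f}.
Proof.
move=> cf; apply/cvg_sup => i U [_ [[W oW <-] /= Wfx]] /filterS; apply.
exact/(cf i)/open_nbhs_nbhs.
Qed.

Lemma ptws_coord_continuous (V : topologicalType) (I : eqType) (i : I) :
  continuous (fun f : {ptws I -> V} => f i).
Proof. exact: (@proj_continuous _ (fun=> V)). Qed.

Section MatrixLimits.
Context {K : numFieldType} {T : Type} {F : set_system T} {FF : Filter F}.

Lemma cvg_mx m n (f : T -> 'M[K]_(m, n)) (A : 'M[K]_(m, n)) :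
  (forall i j, f t i j @[t --> F] --> A i j) -> f @ F --> A.
Proof.
move=> fA U [P AP PU]; rewrite nbhs_simpl /=.
have : \forall t \near F, forall ij : 'I_m * 'I_n, P ij.1 ij.2 (f t ij.1 ij.2).
  by apply: filter_forall => -[i j] /=; exact/fA/AP.
by apply: filterS => t Pt; apply: PU => i j; exact: (Pt (i, j)).
Qed.

Lemma cvg_coord {m n} {f : T -> 'M[K]_(m, n)} {A : 'M[K]_(m, n)} i j :
  f @ F --> A -> f t i j @[t --> F] --> A i j.
Proof. move=> fA; pose e := fun M : 'M[K]_(m, n) => M i j.
exact: (cvg_comp f e fA (@coord_continuous K m n i j A)). Qed.

Lemma cvg_mulmx m n p (f : T -> 'M[K]_(m, n)) (g : T -> 'M[K]_(n, p))
    (A : 'M[K]_(m, n)) (B : 'M[K]_(n, p)) :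
  f @ F --> A -> g @ F --> B -> f t *m g t @[t --> F] --> A *m B.
Proof.
move=> fA gB; apply: cvg_mx => i j; rewrite mxE.
under eq_cvg do rewrite mxE.
apply: cvg_big => [|k _]; first exact: add_continuous.
by apply: cvgM; exact: cvg_coord.
Qed.

Lemma cvg_det n (f : T -> 'M[K]_n) (A : 'M[K]_n) :
  f @ F --> A -> \det (f t) @[t --> F] --> \det A.
Proof.
move=> fA; apply: cvg_big => [|s _]; first exact: add_continuous.
apply: cvgM; first exact: cvg_cst.
apply: cvg_big => [|i _]; first exact: mul_continuous.
exact: cvg_coord.
Qed.

Lemma cvg_adj n (f : T -> 'M[K]_n) (A : 'M[K]_n) :
  f @ F --> A -> \adj (f t) @[t --> F] --> \adj A.
Proof.
move=> fA; apply: cvg_mx => i j; rewrite mxE.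
under eq_cvg do rewrite mxE.
apply: cvgM; first exact: cvg_cst.
apply: cvg_det; apply: cvg_mx => k l; rewrite !mxE.
by under eq_cvg do rewrite !mxE; exact: cvg_coord.
Qed.

Lemma cvg_invmx n (f : T -> 'M[K]_n) (A : 'M[K]_n) :
  A \in unitmx -> (forall t, f t \in unitmx) ->
  f @ F --> A -> invmx (f t) @[t --> F] --> invmx A.
Proof.
move=> uA uf fA; rewrite /invmx uA; under eq_cvg do rewrite uf.
apply: cvgZ; last exact: cvg_adj.
by apply: cvgV; [rewrite -unitfE | exact: cvg_det].
Qed.

End MatrixLimits.

Lemma cvg_inv_neq0 (K : numFieldType) (T : topologicalType) (f : T -> K) x :
  {for x, continuous f} -> f x != 0 ->
  (if f t == 0 then 1 else (f t)^-1) @[t --> x] --> (f x)^-1.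
Proof.
move=> fx fx0; apply: cvg_trans (@cvgV _ _ _ _ _ _ fx0 fx).
apply: near_eq_cvg; near=> t; rewrite ifN //.
by near: t; exact: cvgr_neq0 _ fx fx0.
Unshelve. all: by end_near. Qed.

(* Divide a representative by an entry which does not vanish at p. *)
Lemma local_section (K : numFieldType) m n (S : set 'M[K]_(m, n))
    (Q0 : quotType S) (Q := quotient_topology Q0) (p : Q) :
    (forall (c : K) A, c != 0 -> A \in S -> c *: A \in S) -> 0 \notin S ->
    (forall u v : S, reflect (exists2 c : K, c != 0 & val v = c *: val u)
                             (\pi_Q u == \pi_Q v)) ->
  exists2 s : Q -> S, cancel s \pi_Q & {for p, continuous s}.
Proof.
move=> Sz S0 piP.
have [[i j] /= pij] : exists ij, val (repr p) ij.1 ij.2 != 0.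
  apply/existsP; apply: contraNT S0; rewrite negb_exists => /forallP p0.
  rewrite -[0](_ : val (repr p) = _) ?(valP (repr p)) //.
  by apply/matrixP => i j; rewrite mxE; exact/eqP/negbNE/(p0 (i, j)).
pose e (v : S) : K := val v i j.
have ec : continuous e by move=> v; exact/cvg_coord/cvg_val.
pose c (v : S) : K := if val v i j == 0 then 1 else (val v i j)^-1.
have c0 v : c v != 0.
  by rewrite /c; case: ifPn => [_|?]; rewrite ?oner_eq0 ?invr_eq0.
pose h (v : S) : S := exist _ (c v *: val v) (Sz _ _ (c0 v) (valP v)).
exists (h \o repr) => [q|].
  rewrite /=; apply/eqP; rewrite -[eqbRHS]reprK eq_sym.
  by apply/piP; exists (c (repr q)).
have hZ (u v : S) : \pi_Q u = \pi_Q v -> val u i j != 0 -> h u = h v.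
  move=> /eqP/piP[d d0 uv] uij; apply: val_inj.
  rewrite -[LHS]/(c u *: val u) -[RHS]/(c v *: val v).
  rewrite /c uv mxE mulf_eq0 (negbTE d0) (negbTE uij).
  by rewrite scalerA invfM mulrAC mulVf // mul1r.
have ch (v : S) : val v i j != 0 -> {for v, continuous h}.
  move=> vij; have cv : c @ v --> c v.
    rewrite {2}/c (negbTE vij).
    exact: (@cvg_inv_neq0 K S e v (ec v) vij).
  by apply: continuous_at_val; apply: cvgZ cv _; exact: cvg_val.
move=> U hU; rewrite nbhs_simpl /=.
pose D := [set v : S | val v i j != 0 /\ nbhs (h v) U].
have oD : open D.
  rewrite openE => v [vij hvU]; apply: (@filterI _ _ (@nbhs_filter S v)).
    exact: cvgr_neq0 _ (ec v) vij.
  exact: (ch v vij _ (nbhs_interior hvU)).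
have DS (u v : S) : \pi_Q u = \pi_Q v -> D u -> D v.
  move=> uv [uij huU]; split; last by rewrite -(hZ u).
  by move/eqP/piP : uv => [d d0 ->]; rewrite mxE mulf_neq0.
have : nbhs p [set q | D (repr q)].
  apply: open_nbhs_nbhs; split; last by split.
  rewrite /open /= /quotient_open (_ : _ @^-1` _ = D) //.
  by apply/seteqP; split=> v /=; apply: DS; rewrite reprK.
by apply: filterS => q [_ /nbhs_singleton].
Qed.

Section Columns.
Context {R : comNzRingType} {n : nat}.

Definition mxcols (v : 'I_n -> 'cV[R]_n) : 'M[R]_n := \matrix_(i, j) v j i 0.

Lemma mul_mxcols (A : 'M[R]_n) v : A *m mxcols v = mxcols (fun j => A *m v j).
Proof.
by apply/matrixP => i j; rewrite !mxE; apply: eq_bigr => k _; rewrite mxE.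
Qed.

Lemma det_mxcolsZ (c : 'I_n -> R) v :
  \det (mxcols (fun j => c j *: v j)) = (\prod_j c j) * \det (mxcols v).
Proof.
have -> : mxcols (fun j => c j *: v j) = mxcols v *m diag_mx (\row_j c j).
  by apply/matrixP => i j; rewrite mul_mx_diag !mxE mulrC.
rewrite det_mulmx det_diag mulrC; congr (_ * _).
by apply: eq_bigr => j _; rewrite mxE.
Qed.

End Columns.

Lemma cvg_mxcols {K : numFieldType} {T : Type} {F : set_system T} {FF : Filter F}
    n (f : 'I_n -> T -> 'cV[K]_n) (v : 'I_n -> 'cV[K]_n) :
  (forall j, f j @ F --> v j) -> mxcols (f^~ t) @[t --> F] --> mxcols v.
Proof.
move=> fv; apply: cvg_mx => i j; rewrite mxE.
by under eq_cvg do rewrite mxE; exact: cvg_coord.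
Qed.

Section Frame.
Context {K : numFieldType} {n : nat}.
Implicit Types u : 'I_n.+1 -> 'cV[K]_n.

Definition swap_last (j k : 'I_n) : 'I_n.+1 :=
  if k == j then ord_max else lift ord_max k.

(* By Cramer's rule the matrix sends the standard basis vectors to multiples
   of the first n vectors of u, and their sum to a multiple of the last one. *)
Definition frame_mx u : 'M[K]_n :=
  mxcols (fun j => \det (mxcols (u \o swap_last j)) *: u (lift ord_max j)).

Lemma frame_mxZ (c : 'I_n.+1 -> K) u :
  frame_mx (fun i => c i *: u i) = (\prod_i c i) *: frame_mx u.
Proof.
apply/matrixP => i j; rewrite !mxE.
have -> : \det (mxcols ((fun i => c i *: u i) \o swap_last j)) =
    (\prod_k c (swap_last j k)) * \det (mxcols (u \o swap_last j)).
  exact: (det_mxcolsZ (c \o swap_last j)).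
rewrite mulrACA; congr (_ * _).
rewrite [RHS](bigD1_ord ord_max) //= [in RHS](bigD1 j) //=.
rewrite [in LHS](bigD1 j) //= {1}/swap_last eqxx -mulrA; congr (_ * _).
rewrite mulrC; congr (_ * _).
by apply: eq_bigr => k /negbTE kj; rewrite /swap_last kj.
Qed.

Lemma frame_mxM (A : 'M[K]_n) u :
  frame_mx (fun i => A *m u i) = \det A *: (A *m frame_mx u).
Proof.
have dA j : \det (mxcols ((fun i => A *m u i) \o swap_last j)) =
    \det A * \det (mxcols (u \o swap_last j)).
  by rewrite -det_mulmx mul_mxcols.
rewrite mul_mxcols; apply/matrixP => i j.
rewrite [LHS]mxE [RHS]mxE [X in _ = _ * X]mxE dA [LHS]mxE -scalemxAr.
by rewrite [X in _ = _ * X]mxE mulrA.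
Qed.

Lemma frame_mx_unit u :
  (forall t : 'I_n -> 'I_n.+1, injective t -> \det (mxcols (u \o t)) != 0) ->
  frame_mx u \in unitmx.
Proof.
move=> u0; rewrite unitmxE unitfE det_mxcolsZ mulf_neq0 //; last first.
  by apply: u0; exact: lift_inj.
apply/prodf_neq0 => j _; apply: u0 => k l; rewrite /swap_last.
case: eqVneq => [->|_]; case: eqVneq => [->|_] // /eqP.
- by rewrite eq_liftF.
- by rewrite eq_sym eq_liftF.
- by move=> /eqP/lift_inj.
Qed.

End Frame.

Lemma cvg_frame_mx {K : numFieldType} {T : Type} {F : set_system T}
    {FF : Filter F} n (f : 'I_n.+1 -> T -> 'cV[K]_n) (u : 'I_n.+1 -> 'cV[K]_n) :
  (forall j, f j @ F --> u j) -> frame_mx (f^~ t) @[t --> F] --> frame_mx u.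
Proof.
move=> fu; apply: (@cvg_mxcols _ _ _ _ _
  (fun j t => \det (mxcols (f^~ t \o swap_last j)) *: f (lift ord_max j) t)).
move=> j; apply: cvgZ => //; apply: cvg_det.
by apply: (@cvg_mxcols _ _ _ _ _ (f \o swap_last j)) => k; exact: fu.
Qed.

Section Sections.
Variable K : numFieldType.

Lemma P2_section (p : P2 K) :
  exists2 s : P2 K -> nzvec K, cancel s \pi_(P2 K) & {for p, continuous s}.
Proof.
apply: local_section.
- move=> c v c0 /set_mem v0; apply/mem_set.
  by rewrite /nzvec /= scaler_eq0 negb_or c0.
- by apply/negP => /set_mem; rewrite /nzvec /= eqxx.
- exact: p2_eqP.
Qed.

Lemma PGL3_section (g : PGL3 K) :
  exists2 s : PGL3 K -> GL3 K, cancel s \pi_(PGL3 K) & {for g, continuous s}.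
Proof.
apply: local_section.
- move=> c A c0 /set_mem uA; apply/mem_set.
  by rewrite /GL3 /= unitmxZ ?unitfE.
- by apply/negP => /set_mem; rewrite /GL3 /= unitmxE det0 unitr0.
- exact: pgl_eqP.
Qed.

Lemma pgl_inv_continuous : continuous (@pgl_inv K).
Proof.
move=> g; have [s sK cs] := PGL3_section g.
have -> : @pgl_inv K = \pi_(PGL3 K) \o (@gl_inv K \o s).
  by apply/funext => h; rewrite -[in LHS](sK h) pgl_invE.
apply: continuous_comp; last exact: pi_continuous.
apply: continuous_at_val.
apply: (cvg_invmx (FF := nbhs_filter g) _ (fun h => val (s h)) _ (gl_unit _)
  (fun h => gl_unit (s h))).
exact: cvg_val cs.
Qed.

Lemma p2_act_continuous : continuous (fun gp => @p2_act K gp.1 gp.2).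
Proof.
move=> [g p]; have [s sK cs] := PGL3_section g; have [t tK ct] := P2_section p.
have -> : (fun gp => @p2_act K gp.1 gp.2) =
    \pi_(P2 K) \o (fun gp => gl_act (s gp.1) (t gp.2)).
  by apply/funext => -[h q] /=; rewrite -[in LHS](sK h) -[in LHS](tK q) p2_actE.
apply: continuous_comp; last exact: pi_continuous.
have cs1 : {for (g, p), continuous (s \o fst)}.
  by apply: continuous_comp; [exact: cvg_fst | exact: cs].
have ct2 : {for (g, p), continuous (t \o snd)}.
  by apply: continuous_comp; [exact: cvg_snd | exact: ct].
apply: continuous_at_val; apply: (cvg_mulmx (FF := nbhs_filter (g, p))).
  exact: cvg_val cs1.
exact: cvg_val ct2.
Qed.

End Sections.

Section Trivialization.
Variables (K : numFieldType) (n : nat).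
Hypothesis n_gt3 : (3 < n)%N.
Local Notation F := (F K n).
Local Notation X := (X K n).

Lemma F_coord_continuous (i : 'I_n) : continuous (fun x : F => val x i).
Proof.
move=> x; pose e := fun z : {ptws 'I_n -> P2 K} => z i.
exact: (cvg_comp _ e (@initial_continuous F _ set_val x)
                     (@ptws_coord_continuous (P2 K) _ i (val x))).
Qed.

Definition frame_point (x : F) (i : 'I_4) : P2 K := val x (widen_ord n_gt3 i).

Lemma lifted_frame_unit (x : F) (y : 'I_4 -> nzvec K) :
  (forall i, \pi_(P2 K) (y i) = frame_point x i) ->
  frame_mx (fun i => val (y i)) \in unitmx.
Proof.
move=> yx; apply: frame_mx_unit => t tinj; apply/det0P => -[l l0 ly].
have [_ /(_ (widen_ord n_gt3 (t 0)) (widen_ord n_gt3 (t 1))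
           (widen_ord n_gt3 (t 2%:R)))] := set_mem (valP x).
apply; rewrite -?val_eqE /= ?val_eqE ?(inj_eq tinj) //.
have lt j : line l (frame_point x (t j)).
  rewrite -yx line_pi; apply/matrixP => i k; rewrite !ord1 mxE.
  have := congr1 (fun A : 'rV_3 => A 0 j) ly; rewrite !mxE => {2}<-.
  by apply: eq_bigr => a _; rewrite mxE.
by exists l => //; split; exact: lt.
Qed.

Definition frame_of (x : F) : PGL3 K :=
  \pi_(PGL3 K) (gl_of (@lifted_frame_unit x (fun i => repr (frame_point x i))
                         (fun i => reprK (frame_point x i)))).

Lemma frame_of_lift (x : F) (y : 'I_4 -> nzvec K)
    (yx : forall i, \pi_(P2 K) (y i) = frame_point x i) :
  frame_of x = \pi_(PGL3 K) (gl_of (lifted_frame_unit x y yx)).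
Proof.
have /choice[c cP] (i : 'I_4) : exists c : K,
    c != 0 /\ val (y i) = c *: val (repr (frame_point x i)).
  have /eqP/p2_eqP[c c0 yc] :
      \pi_(P2 K) (repr (frame_point x i)) = \pi_(P2 K) (y i).
    by rewrite reprK yx.
  by exists c.
apply/eqP/pgl_eqP; exists (\prod_i c i).
  by apply/prodf_neq0 => i _; have [] := cP i.
rewrite /= -frame_mxZ; congr frame_mx; apply/funext => i.
by have [_ ->] := cP i.
Qed.

Lemma frame_of_act (g : PGL3 K) (x : F) :
  frame_of (F_act g x) = (g * frame_of x)%g.
Proof.
elim/quotW: g => A.
have yx i : \pi_(P2 K) (gl_act A (repr (frame_point x i))) =
    frame_point (F_act (\pi_(PGL3 K) A) x) i.
  by rewrite -p2_actE reprK.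
rewrite (frame_of_lift _ _ yx) [RHS]pgl_mulE; apply/esym/eqP/pgl_eqP.
exists (\det (val A)); first by rewrite -unitfE -unitmxE gl_unit.
exact: frame_mxM.
Qed.

Lemma frame_of_continuous : continuous frame_of.
Proof.
move=> x.
have /choice[s sP] (i : 'I_4) : exists s : P2 K -> nzvec K,
    cancel s \pi_(P2 K) /\ {for frame_point x i, continuous s}.
  by have [s] := P2_section _ (frame_point x i); exists s.
have sx z i : \pi_(P2 K) (s i (frame_point z i)) = frame_point z i.
  by have [sK _] := sP i; rewrite sK.
rewrite (_ : frame_of =
    \pi_(PGL3 K) \o (fun z => gl_of (lifted_frame_unit z _ (sx z)))); last first.
  by apply/funext => z; exact: frame_of_lift.
apply: continuous_comp; last exact: pi_continuous.
apply: continuous_at_val.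
apply: (cvg_frame_mx (FF := nbhs_filter x) _
  (fun i z => val (s i (frame_point z i)))) => i.
have cs : {for x, continuous (s i \o frame_point^~ i)}.
  apply: continuous_comp; last by have [] := sP i.
  exact: F_coord_continuous.
exact: cvg_val cs.
Qed.

Lemma F_act_continuous : continuous (fun gx => @F_act K n gx.1 gx.2).
Proof.
move=> [g x]; apply: continuous_at_val; apply: continuous_at_ptws => i.
apply: (continuous_comp (f := fun gx : PGL3 K * F => (gx.1, val gx.2 i))
  (g := fun gp => @p2_act K gp.1 gp.2)); last exact: p2_act_continuous.
apply: continuous_at_pair; first exact: cvg_fst.
apply: (continuous_comp (f := snd) (g := fun z : F => val z i)).
  exact: cvg_snd.
exact: F_coord_continuous.
Qed.

Definition normalize (x : F) : F := F_act (frame_of x)^-1%g x.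

Lemma normalize_continuous : continuous normalize.
Proof.
move=> x; apply: (continuous_comp (f := fun z => (pgl_inv (frame_of z), z))
  (g := fun gz => @F_act K n gz.1 gz.2)); last exact: F_act_continuous.
apply: continuous_at_pair; last exact: cvg_id.
apply: continuous_comp; first exact: frame_of_continuous.
exact: pgl_inv_continuous.
Qed.

Lemma normalize_act g x : normalize (F_act g x) = normalize x.
Proof. by rewrite /normalize frame_of_act -F_actM invgM -mulgA mulVg mulg1. Qed.

Lemma F_proj_act g x : F_proj (@F_act K n g x) = F_proj x.
Proof.
apply/esym/(@eqmodP _ (@same_orbit_equiv_rel K n))/asboolP.
by exists g.
Qed.

Lemma normalize_repr_proj x : normalize (repr (F_proj x)) = normalize x.
Proof.
have /esym/(@eqmodP _ (@same_orbit_equiv_rel K n))/asboolP[g ->] :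
  \pi_X (repr (F_proj x)) = \pi_X x by rewrite reprK.
exact: normalize_act.
Qed.

Lemma F_proj_trivial :
  trivial_principal_bundle (fun g h : PGL3 K => (g * h)%g)
    (fun g (x : F) => F_act g x) (@F_proj K n).
Proof.
exists (fun x => (F_proj x, frame_of x)).
exists (fun bg => F_act bg.2 (normalize (repr bg.1))); split=> //.
- split=> [x|[b g]] /=.
    by rewrite normalize_repr_proj /normalize -F_actM mulgV F_act1.
  rewrite F_proj_act /normalize F_proj_act frame_of_act frame_of_act.
  by rewrite mulVg mulg1 /F_proj reprK.
- split.
    move=> x; apply: continuous_at_pair; last exact: frame_of_continuous.
    exact: pi_continuous.
  have cn : continuous (normalize \o repr : X -> F).
    apply/quotient_continuous.
    rewrite (_ : _ \o _ = normalize); first exact: normalize_continuous.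
    by apply/funext => x; exact: normalize_repr_proj.
  move=> [b g]; apply: (continuous_comp
    (f := fun bg : X * PGL3 K => (bg.2, normalize (repr bg.1)))
    (g := fun gz => @F_act K n gz.1 gz.2)); last exact: F_act_continuous.
  apply: continuous_at_pair; first exact: cvg_snd.
  apply: (continuous_comp (f := fst : X * PGL3 K -> X)
    (g := normalize \o repr : X -> F)).
    exact: cvg_fst.
  exact: cn.
- by move=> g x; rewrite F_proj_act frame_of_act.
Qed.

End Trivialization.

Theorem proposition2p7 (R : realType) (n : nat) (hn : (4 < n)%N) :
  @trivial_principal_bundle (PGL3 R[i]) (F R[i] n) (X R[i] n)
    (fun g h => (g * h)%g) (fun g x => F_act g x) (@F_proj R[i] n).
Proof. exact: F_proj_trivial (ltnW hn). Qed.
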